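(* (1) There exists a $6$-point metric space $T$ such that $\mathrm{TC}(T)$ contains a linear subspace isometric to $\ell_\infty^3$. (2) There exists an $8$-point metric space $F$ such that $\mathrm{TC}(F)$ contains a linear subspace isometric to $\ell_\infty^4$.
   Context: Transportation cost space: for a finite metric space $(X,d)$, $\mathrm{TC}(X)$ is the space of all functions $f:X\to\mathbb{R}$ with $\sum_{v\in X}f(v)=0$, with norm $\|f\|_{\mathrm{TC}}=\inf \sum_i a_i d(x_i,y_i)$, the infimum over all finite representations $f=\sum_i a_i(\mathbf{1}_{x_i}-\mathbf{1}_{y_i})$ with $a_i\ge0$, $x_i,y_i\in X$, where $\mathbf 1_u$ is the indicator function of $u$. *)

(* Defs.v *)
From HB Require Import structures.
From mathcomp Require Import all_boot all_order all_algebra.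
From mathcomp Require Import mathcomp_extra boolp classical_sets functions reals.
From mathcomp Require Import topology normedtype.

Set Implicit Arguments.
Unset Strict Implicit.
Unset Printing Implicit Defensive.

Import Order.TTheory GRing.Theory Num.Theory.
Import numFieldNormedType.Exports.

Local Open Scope classical_set_scope.
Local Open Scope ring_scope.

#[short(type="finMetricType")]
HB.structure Definition FinMetric (K : numDomainType) :=
  { M of Finite M & Metric K M }.

Section TransportationCost.
Variables (R : realType) (X : finMetricType R).

(* [R^o] is [R] seen as a module over itself; it gives [{ffun X -> R^o}] its
   pointwise module structure. *)
Definition sum_zero : {pred {ffun X -> R^o}} := 
  [pred f : {ffun X -> R^o} | \sum_v f v == 0].

Fact sum_zero_submod_closed : GRing.submod_closed sum_zero.
Proof.
split=> [|a f g]; rewrite !inE.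
  by rewrite big1 // => v _; rewrite ffunE.
move=> /eqP f0 /eqP g0; apply/eqP.
under eq_bigr do rewrite !ffunE.
by rewrite big_split -scaler_sumr f0 g0 /= scaler0 addr0.
Qed.

HB.instance Definition _ :=
  GRing.isSubmodClosed.Build R {ffun X -> R^o} sum_zero sum_zero_submod_closed.

Record TC := MkTC {tc_fun :> {ffun X -> R^o}; _ : tc_fun \in sum_zero}.

HB.instance Definition _ := [isSub for tc_fun].
HB.instance Definition _ := [Choice of TC by <:].
HB.instance Definition _ := [SubChoice_isSubLmodule of TC by <:].

Definition ind (u : X) : {ffun X -> R^o} := [ffun v => (v == u)%:R].

Definition tc_costs (f : {ffun X -> R^o}) : set R :=
  [set c | exists (n : nat) (a : 'I_n -> R) (x y : 'I_n -> X),
    [/\ forall i, 0 <= a i,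
        f = \sum_i a i *: (ind (x i) - ind (y i))
      & c = \sum_i a i * mdist (x i) (y i)]].

Definition tc_norm (f : {ffun X -> R^o}) : R := inf (tc_costs f).

Lemma tc_costs_fin (I : finType) (a : I -> R) (x y : I -> X) :
  (forall i, 0 <= a i) ->
  tc_costs (\sum_i a i *: (ind (x i) - ind (y i)))
           (\sum_i a i * mdist (x i) (y i)).
Proof.
move=> a0; exists #|I|, (a \o enum_val), (x \o enum_val), (y \o enum_val).
by split=> [i||]; [exact: a0 | rewrite big_enum_val ..].
Qed.

Lemma tc_costs_ge0 f c : tc_costs f c -> 0 <= c.
Proof.
move=> [n [a [x [y [a0 _ ->]]]]]; apply: sumr_ge0 => i _.
by rewrite mulr_ge0 // mdist_ge0.
Qed.

Lemma tc_costs_lbound f : has_lbound (tc_costs f).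
Proof. by exists 0 => c; exact: tc_costs_ge0. Qed.

Lemma tc_costs_neq0 (f : TC) : tc_costs f !=set0.
Proof.
have [x0|X0] := pickP (@predT X); last first.
  have x1 : 'I_0 -> X by case.
  exists 0, 0%N, (fun=> 0), x1, x1.
  split=> //; last by rewrite big_ord0.
  by apply/ffunP => v; have := X0 v.
move=> _; pose x v := if 0 <= f v then v else x0.
pose y v := if 0 <= f v then x0 else v.
suff -> : (f : {ffun _ -> _}) = \sum_v `|f v| *: (ind (x v) - ind (y v)).
  by eexists; exact: tc_costs_fin.
have E v : `|f v| *: (ind (x v) - ind (y v)) = f v *: (ind v - ind x0).
  rewrite /x /y; case: ifPn => [f0|]; first by rewrite ger0_norm.
  by rewrite -ltNge => f0; rewrite ltr0_norm // scaleNr -scalerN opprB.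
under eq_bigr do rewrite E scalerBr.
rewrite sumrB -scaler_suml.
have /eqP -> : \sum_v f v == 0 by have := valP f; rewrite inE.
rewrite scale0r subr0; apply/ffunP => v; rewrite sum_ffunE (bigD1 v) //=.
rewrite big1 ?addr0 => [|w wv]; rewrite !ffunE ?eqxx /GRing.scale/= ?mulr1 //.
by rewrite eq_sym (negbTE wv) mulr0.
Qed.

Lemma tc_norm_le f c : tc_costs f c -> tc_norm f <= c.
Proof. by move=> fc; apply: ge_inf => //; exact: tc_costs_lbound. Qed.

Lemma tc_norm_lb (f : TC) c :
  (forall c', tc_costs f c' -> c <= c') -> c <= tc_norm f.
Proof. by move=> h; apply: lb_le_inf => //; exact: tc_costs_neq0. Qed.

Lemma tc_normD (f g : TC) : tc_norm (f + g : TC) <= tc_norm f + tc_norm g.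
Proof.
rewrite -lerBlDl; apply: tc_norm_lb => c2 [m [b [z [t [b0 gE ->]]]]].
rewrite lerBlDr -lerBlDl; apply: tc_norm_lb => c1.
move=> [n [a [x [y [a0 fE ->]]]]]; rewrite lerBlDr.
pose s T (u : 'I_n -> T) (w : 'I_m -> T) (i : 'I_n + 'I_m) :=
  match i with inl i => u i | inr j => w j end.
have := @tc_costs_fin _ (s _ a b) (s _ x z) (s _ y t).
rewrite !big_sumType /= -fE -gE => h.
by apply: tc_norm_le; apply: h; case.
Qed.

Lemma tc_costsZ l f c : tc_costs f c -> tc_costs (l *: f) (`|l| * c).
Proof.
move=> [n [a [x [y [a0 -> ->]]]]].
exists n, (fun i => `|l| * a i).
exists (if 0 <= l then x else y), (if 0 <= l then y else x).
split=> [i||]; first by rewrite mulr_ge0.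
- rewrite scaler_sumr; apply: eq_bigr => i _; rewrite -!scalerA.
  case: ifPn => [l0|]; first by rewrite ger0_norm.
  by rewrite -ltNge => l0; rewrite ltr0_norm // scaleNr -scalerN -scalerN opprB.
- rewrite mulr_sumr; apply: eq_bigr => i _; rewrite mulrA.
  by case: ifPn => // _; rewrite metric_sym.
Qed.

Lemma tc_normZ l (f : TC) : tc_norm (l *: f : TC) = `|l| * tc_norm f.
Proof.
have le k (g : TC) : tc_norm (k *: g : TC) <= `|k| * tc_norm g.
  have [->|k0] := eqVneq k 0.
    rewrite normr0 mul0r; have [c /(tc_costsZ 0)] := tc_costs_neq0 g.
    by rewrite normr0 mul0r => /tc_norm_le.
  rewrite -ler_pdivrMl ?normr_gt0 //; apply: tc_norm_lb => c gc.
  by rewrite ler_pdivrMl ?normr_gt0 //; apply: tc_norm_le; exact: tc_costsZ.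
apply/eqP; rewrite eq_le le andTb; have [->|l0] := eqVneq l 0.
  by rewrite normr0 mul0r; apply: tc_norm_lb => c /tc_costs_ge0.
have := le l^-1 (l *: f); rewrite scalerA mulVf // scale1r normfV.
by rewrite ler_pdivlMl ?normr_gt0.
Qed.

Lemma tc_norm_eq0 (f : TC) : tc_norm f = 0 -> f = 0.
Proof.
move=> f0; apply: val_inj; apply/ffunP => v; rewrite [RHS]ffunE.
pose K : R := \sum_(p : X * X) (mdist p.1 p.2)^-1.
have K0 : 0 <= K by apply: sumr_ge0 => p _; rewrite invr_ge0 mdist_ge0.
have Kd x y : `|ind x v - ind y v| <= K * mdist x y.
  have [->|xy] := eqVneq x y; first by rewrite subrr normr0 mdistxx mulr0.
  have d0 : 0 < mdist x y by rewrite mdist_gt0.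
  apply: (@le_trans _ _ 1).
    rewrite !ffunE; case: (v == x); case: (v == y);
      by rewrite ?subrr ?subr0 ?sub0r ?normrN ?normr0 ?normr1.
  rewrite -ler_pdivrMr // mul1r /K (bigD1 (x, y)) //= lerDl.
  by apply: sumr_ge0 => p _; rewrite invr_ge0 mdist_ge0.
have fK : `|f v| <= K * 0.
  rewrite -f0; have [K0'|Kn0] := eqVneq K 0.
    have [c [n [a [x [y [a0 -> _]]]]]] := tc_costs_neq0 f.
    rewrite K0' mul0r sum_ffunE; apply: le_trans (ler_norm_sum _ _ _) _.
    rewrite big1 // => i _; have := Kd (x i) (y i).
    by rewrite K0' mul0r !ffunE normrZ normr_le0 => /eqP ->; rewrite normr0 mulr0.
  have Kp : 0 < K by rewrite lt_neqAle eq_sym Kn0.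
  rewrite -ler_pdivrMl //; apply: tc_norm_lb => c.
  move=> [n [a [x [y [a0 -> ->]]]]]; rewrite ler_pdivrMl // sum_ffunE mulr_sumr.
  apply: le_trans (ler_norm_sum _ _ _) _; apply: ler_sum => i _.
  rewrite ffunE normrZ ger0_norm // mulrCA ler_wpM2l //.
  by have := Kd (x i) (y i); rewrite !ffunE.
by apply/eqP; rewrite -normr_le0 (le_trans fK) // mulr0.
Qed.

HB.instance Definition _ := @Lmodule_isNormed.Build R TC
  (fun f : TC => tc_norm f) tc_normD tc_normZ tc_norm_eq0.

Lemma TC_normE (f : TC) : `|f| = inf (tc_costs f).
Proof. by []. Qed.

End TransportationCost.

(* "Isometric" is meant in the category of normed spaces: a linear norm-preserving
   bijection from [V] onto the subspace [S] of [E]. *)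
Definition contains_isometric_copy (R : realType) (V E : normedModType R) :=
  exists2 S : {pred E}, GRing.submod_closed S &
  exists phi : {linear V -> E},
    (forall x, `|phi x| = `|x|) /\ (forall y, y \in S <-> exists x, phi x = y).

(* The library norm of ['rV[R]_n] is the max norm, so ['rV[R]_n] as a normed
   module is $\ell_\infty^n$. *)
Lemma rV_normE (R : realType) (n : nat) (x : 'rV[R]_n) :
  `|x| = \big[Num.max/0]_j `|x 0 j|.
Proof.
rewrite [LHS]mx_normrE; apply/eqP; rewrite eq_le; apply/andP; split.
- apply: bigmax_le => [|[i j] _]; first exact: bigmax_ge_id.
  by rewrite ord1; exact: (le_bigmax _ (fun j => `|x 0 j|)).
- apply: bigmax_le => [|j _]; first exact: bigmax_ge_id.
  exact: (le_bigmax _ (fun ij => `|x ij.1 ij.2|) (0, j)).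
Qed.

(* Main.v *)
Require Import Defs.
From HB Require Import structures.
From mathcomp Require Import all_boot all_order all_algebra.
From mathcomp Require Import mathcomp_extra boolp classical_sets functions reals.
From mathcomp Require Import topology normedtype.
From mathcomp Require Import ring lra.

Set Implicit Arguments.
Unset Strict Implicit.
Unset Printing Implicit Defensive.

Import Order.TTheory GRing.Theory Num.Theory.
Import numFieldNormedType.Exports.

Local Open Scope ring_scope.

(** The spaces are the vertex sets of [K_{4,2}] and [K_{4,4}] with the graph
    metric.  Label a side of four vertices by the sign pairs [s = (s_1, s_2)],
    write [x_s] for its vertices and put [f_i = (1/4) \sum_s s_i 1_{x_s}]; on a
    side of two vertices put [f = (1/2) (1_{y_+} - 1_{y_-})].  On each side a
    signed sum of these is [(1/2) (1_{x_e} - 1_{x_{-e}})], so a signed sum over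
    both sides is transported at cost 1 along the edges [x_e -> y_{-e'}] and
    [y_{e'} -> x_{-e}].  By convexity [\sum_i c_i f_i] has norm at most
    [max_i |c_i|].  Conversely the coordinate [s_i], extended by 0 to the other
    side, is 1-Lipschitz and biorthogonal to the [f_j]. *)

(** * Convexity: reduction from a cube to its vertices *)

(** A norm is convex, so its bound at the vertices of the cube [[-m, m]^n] holds on the whole cube.
    The offset [u] is there for the induction: it absorbs the coordinate already fixed. *)
Lemma norm_sum_signs_le (R : realType) (V : normedModType R) (n : nat)
    (f : 'I_n -> V) (u : V) (m B : R) :
  (forall e : 'I_n -> bool, `|u + \sum_i ((-1) ^+ e i * m) *: f i| <= B) ->
  forall c : 'I_n -> R, (forall i, `|c i| <= m) ->
  `|u + \sum_i c i *: f i| <= B.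
Proof.
elim: n f u => [|n IHn] f u fB c cm.
  by have := fB (fun=> false); rewrite !big_ord0.
rewrite big_ord_recl addrA; apply: IHn => [e|i]; last exact: cm.
set w := \sum_i _.
have ext (b : bool) : `|u + ((-1) ^+ b * m) *: f ord0 + w| <= B.
  have := fB (fun i => if unlift ord0 i is Some j then e j else b).
  rewrite big_ord_recl unlift_none addrA /w.
  by under eq_bigr do rewrite liftK.
have c0 := cm ord0.
(* The convex weights [(m + c) / 2m] and [(m - c) / 2m] need [m] nonzero. When [m = 0], the bound on
   [c ord0] makes it equal to [m], itself a vertex. *)
have [m0|m0] := eqVneq m 0.
  have := ext false; suff -> : c ord0 = m by rewrite expr0 mul1r.
  by apply/eqP; rewrite m0 -normr_le0 -m0.
have mp : 0 < m by rewrite lt_neqAle eq_sym m0 (le_trans _ c0).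
rewrite -(ler_pM2l (_ : 0 < m + m)); last by rewrite addr_gt0.
(* The convex combination of the vertices [m] and [-m], cleared of the denominator [2m]. *)
have -> : (m + m) * `|u + c ord0 *: f ord0 + w| =
    `|(m + c ord0) *: (u + m *: f ord0 + w) +
      (m - c ord0) *: (u + (- m) *: f ord0 + w)|.
  rewrite -{1}(@ger0_norm _ (m + m)) ?addr_ge0 ?ltW // -normrZ; congr `|_|.
  rewrite !scalerDr !scalerA addrACA -scalerDl (addrACA (_ *: u)) -!scalerDl.
  by congr (_ *: _ + _ *: _ + _ *: _); ring.
move: c0; rewrite ler_norml => /andP[cl cr].
apply: le_trans (ler_normD _ _) _; rewrite !normrZ.
rewrite (ger0_norm (_ : 0 <= m + c ord0)); last by lra.
rewrite (ger0_norm (_ : 0 <= m - c ord0)); last by lra.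
have -> : (m + m) * B = (m + c ord0) * B + (m - c ord0) * B by ring.
have := ext true; have := ext false; rewrite expr0 expr1 mul1r mulN1r => e0 e1.
by apply: lerD; apply: ler_wpM2l => //; lra.
Qed.

(** * Lower bounds by Lipschitz functions *)

Section Duality.
Variables (R : realType) (X : finMetricType R).

Lemma TC_sumE (n : nat) (c : 'I_n -> R) (f : 'I_n -> TC X) :
  (\sum_i c i *: f i : TC X) = \sum_i c i *: (f i : {ffun X -> R^o})
    :> {ffun X -> R^o}.
Proof. by apply: (big_morph (@tc_fun R X)). Qed.

(** The easy half of Kantorovich duality: pairing with [g] turns each term of a representation into
    [a i * (g (x i) - g (y i))], which is at most its cost. *)
Lemma TC_norm_ge (f : TC X) (g : X -> R) :
  (forall x y, g x - g y <= mdist x y) -> \sum_v f v * g v <= `|f|.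
Proof.
move=> gL; apply: tc_norm_lb => c [n [a [x [y [a0 -> ->]]]]].
under eq_bigr do rewrite sum_ffunE mulr_suml.
rewrite exchange_big /=; apply: ler_sum => i _.
have ind_g z : \sum_v ind z v * g v = g z.
  rewrite (bigD1 z) //= big1 => [|v vz]; rewrite ffunE.
    by rewrite eqxx mul1r addr0.
  by rewrite (negbTE vz) mul0r.
suff -> : \sum_v (a i *: (ind (x i) - ind (y i))) v * g v =
    a i * (g (x i) - g (y i)) by rewrite ler_wpM2l.
rewrite -!ind_g -sumrB mulr_sumr; apply: eq_bigr => v _.
by rewrite !ffunE -mulrBl mulrA.
Qed.

(** The isometry maps the [i]-th unit vector to [f i]. The sign bound gives its upper estimate by
    convexity; pairing with [g j] recovers the [j]-th coordinate and gives the lower one. *)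
Lemma biorthogonal_linfty_copy (n : nat) (f : 'I_n -> TC X)
    (g : 'I_n -> X -> R) :
  (forall i x y, g i x - g i y <= mdist x y) ->
  (forall i j, \sum_v f i v * g j v = (i == j)%:R) ->
  (forall e : 'I_n -> bool, `|\sum_i (-1) ^+ e i *: f i| <= 1) ->
  contains_isometric_copy 'rV[R]_n (TC X).
Proof.
move=> gL fg f1; pose phi (x : 'rV[R]_n) : TC X := \sum_i x 0 i *: f i.
have phi_lin : linear phi.
  move=> a x y; rewrite /phi scaler_sumr -big_split; apply: eq_bigr => i _.
  by rewrite !mxE scalerDl scalerA.
pose Phi : {linear 'rV[R]_n -> TC X} :=
  HB.pack phi (GRing.isLinear.Build R 'rV[R]_n (TC X) _ phi phi_lin).
exists (fun y => `[< exists x, phi x = y >]).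
  split=> [|a y z]; first by apply/asboolP; exists 0; exact: (raddf0 Phi).
  move=> /asboolP[x <-] /asboolP[x' <-]; apply/asboolP.
  by exists (a *: x + x'); exact: (linearP Phi).
exists Phi; split=> [x|y]; last by split => /asboolP.
have phi_g j : \sum_v phi x v * g j v = x 0 j.
  rewrite TC_sumE; under eq_bigr do rewrite sum_ffunE mulr_suml.
  rewrite exchange_big /= (eq_bigr (fun i => x 0 i * (i == j)%:R)) => [|i _].
    rewrite (bigD1 j) //= eqxx mulr1 big1 ?addr0 // => i ij.
    by rewrite (negbTE ij) mulr0.
  by rewrite -fg mulr_sumr; apply: eq_bigr => v _; rewrite ffunE mulrA.
change (`|phi x| = `|x|); apply/eqP; rewrite eq_le; apply/andP; split.
  rewrite -[phi x]add0r; apply: (@norm_sum_signs_le _ _ _ _ _ `|x|) => [e|i]; last first.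
    by rewrite rV_normE; exact: (le_bigmax _ (fun j => `|x 0 j|)).
  rewrite add0r; under eq_bigr do rewrite mulrC -scalerA.
  by rewrite -scaler_sumr normrZ normr_id ler_piMr.
rewrite rV_normE; apply: bigmax_le => // j _.
rewrite ler_norml; apply/andP; split; rewrite -phi_g; last exact: TC_norm_ge.
(* The other sign is obtained from [- g j], which is 1-Lipschitz by symmetry of the distance. *)
rewrite lerNl -sumrN -(eq_bigr _ (fun v _ => mulrN _ _)).
by apply: TC_norm_ge => u v; rewrite opprK addrC metric_sym.
Qed.

End Duality.

(* [R] does not occur in the carrier; it only selects the scalars of the metric
   instance below. *)
Definition bipartite (R : realType) (A B : finType) : Type := (A + B)%type.

(** * The metric of a complete bipartite graph *)

Section BipartiteMetric.
Variables (R : realType) (A B : finType).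

HB.instance Definition _ := Finite.copy (bipartite R A B) (A + B)%type.

Definition bipartite_dist (x y : bipartite R A B) : R :=
  match x, y with
  | inl a, inl a' => 2 * (a != a')%:R
  | inr b, inr b' => 2 * (b != b')%:R
  | _, _ => 1
  end.

Lemma bipartite_distxx x : bipartite_dist x x = 0.
Proof. by case: x => a; rewrite /= eqxx mulr0. Qed.

Lemma bipartite_dist_eq0 x y : bipartite_dist x y = 0 -> x = y.
Proof.
case: x y => [a|b] [a'|b'] /=; try (by move=> /eqP; rewrite oner_eq0);
  by case: eqVneq => [->//|_] /eqP; rewrite mulr1 pnatr_eq0.
Qed.

Lemma bipartite_dist_sym x y : bipartite_dist x y = bipartite_dist y x.
Proof. by case: x y => [a|b] [a'|b'] //=; rewrite eq_sym. Qed.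

Lemma bipartite_dist_triangle y x z :
  bipartite_dist x z <= bipartite_dist x y + bipartite_dist y z.
Proof.
(* If [x] and [y] share a side, they coincide or are already at the maximal distance 2. Otherwise
   their distance is 1, and parity settles both positions of [z]. *)
case: x y z => [x|x] [y|y] [z|z] /=;
  by [case: (eqVneq x y) => [->|_]; do ?case: eqVneq => _ /=; lra
     | do ?case: eqVneq => _ /=; lra].
Qed.

HB.instance Definition _ := @isMetric.Build R (bipartite R A B) bipartite_dist
  bipartite_distxx bipartite_dist_eq0 bipartite_dist_sym
  bipartite_dist_triangle.

End BipartiteMetric.

(** * Sign coordinates on a single side *)

(** The fields serve, in order, the Lipschitz bound, membership in [TC], biorthogonality and the
    upper norm bound. After division by [#|A|], the last one makes every signed sum half a
    dipole. *)
Record sign_frame (R : realType) (A : finType) (p : nat) (s : 'I_p -> A -> R) :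
    Prop := SignFrame {
  sign_frame_le1 : forall i a, `|s i a| <= 1;
  sign_frame_sum : forall i, \sum_a s i a = 0;
  sign_frame_orth : forall i j, \sum_a s i a * s j a = #|A|%:R * (i == j)%:R;
  sign_frame_dipole : forall e : 'I_p -> bool, exists a a', forall c,
    \sum_i (-1) ^+ e i * s i c = #|A|%:R / 2 * ((c == a)%:R - (c == a')%:R) }.

Lemma sign_frame_bool (R : realType) :
  @sign_frame R bool 1 (fun _ a => (-1) ^+ a).
Proof.
split=> [i a|i|i j|e].
- by rewrite normr_sign.
- by rewrite big_bool /= expr1 expr0; lra.
- by rewrite !ord1 big_bool card_bool /= expr1 expr0; lra.
exists (e 0), (~~ e 0) => c; rewrite big_ord_recl big_ord0 card_bool.
by case: (e _) c => -[] /=; rewrite ?expr1 ?expr0; lra.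
Qed.

Lemma sign_frame_bool2 (R : realType) :
  @sign_frame R (bool * bool)%type 2
    (fun i a => (-1) ^+ (if i == 0 then a.1 else a.2)).
Proof.
have sumE (F : bool * bool -> R) : \sum_a F a =
    F (true, true) + F (true, false) + F (false, true) + F (false, false).
  transitivity (\sum_(a : bool) \sum_(b : bool) F (a, b)).
    by rewrite pair_bigA; apply: eq_bigr => -[].
  by rewrite !big_bool /= addrA.
split=> [i a|i|i j|e].
- by rewrite normr_sign.
- by rewrite sumE; case: eqP => _ /=; rewrite expr1 expr0; lra.
- rewrite sumE card_prod card_bool.
  case: i j => [[|[]]] // ? [[|[]]] // ?; rewrite /eq_op /= ?expr1 ?expr0; lra.
(* The two signs add up to 2 at [c = e], to -2 at the opposite pair, and cancel at the two mixed
   pairs. *)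
exists (e 0, e 1), (~~ e 0, ~~ e 1) => c.
rewrite 2!big_ord_recl big_ord0 card_prod card_bool.
rewrite (_ : lift ord0 ord0 = 1); last exact: val_inj.
case: c => -[] [] /=; case: (e 0); case: (e 1);
  by rewrite /eq_op /= ?expr1 ?expr0; lra.
Qed.

(** * Gluing the frames of the two sides *)

Section BipartiteCopy.
Variables (R : realType) (A B : finType) (p q : nat).
Variables (s : 'I_p -> A -> R) (t : 'I_q -> B -> R).
Hypotheses (sP : sign_frame s) (tP : sign_frame t).
Local Notation X := (bipartite R A B).

Definition bipartite_coord (i : 'I_(p + q)) (x : X) : R :=
  match fintype.split i, x with
  | inl j, inl a => s j a
  | inr j, inr b => t j b
  | _, _ => 0
  end.

Definition bipartite_frame_fun (i : 'I_(p + q)) : {ffun X -> R^o} :=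
  [ffun x => bipartite_coord i x / (if fintype.split i is inl _ then #|A| else #|B|)%:R].

Lemma sum_bipartite (F : X -> R) :
  \sum_x F x = \sum_a F (inl a) + \sum_b F (inr b).
Proof. exact: big_sumType. Qed.

Lemma bipartite_frame_subproof i :
  bipartite_frame_fun i \in @sum_zero R X.
Proof.
rewrite inE sum_bipartite; apply/eqP.
under eq_bigr do rewrite ffunE /bipartite_coord.
under [X in _ + X]eq_bigr do rewrite ffunE /bipartite_coord.
rewrite -!mulr_suml; case: (fintype.split i) => j.
  by rewrite (sign_frame_sum sP) big1 // !mul0r addr0.
by rewrite (sign_frame_sum tP) big1 // !mul0r addr0.
Qed.

Definition bipartite_frame i : TC X := MkTC (bipartite_frame_subproof i).

(** Values in [[-1, 1]] differ by at most 2, the distance of distinct points on one side; across an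
    edge one of the values is 0, so the difference is at most 1. *)
Lemma bipartite_coord_lipschitz i (x y : X) :
  bipartite_coord i x - bipartite_coord i y <= mdist x y.
Proof.
have ds (a a' : A) j : s j a - s j a' <= 2 * (a != a')%:R.
  have := sign_frame_le1 sP j a; have := sign_frame_le1 sP j a'.
  rewrite !ler_norml => /andP[? ?] /andP[? ?].
  by case: eqVneq => [->|_] /=; lra.
have dt (b b' : B) j : t j b - t j b' <= 2 * (b != b')%:R.
  have := sign_frame_le1 tP j b; have := sign_frame_le1 tP j b'.
  rewrite !ler_norml => /andP[? ?] /andP[? ?].
  by case: eqVneq => [->|_] /=; lra.
have s1 a j : s j a <= 1 /\ - s j a <= 1.
  by have := sign_frame_le1 sP j a; rewrite ler_norml => /andP[? ?]; lra.
have t1 b j : t j b <= 1 /\ - t j b <= 1.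
  by have := sign_frame_le1 tP j b; rewrite ler_norml => /andP[? ?]; lra.
rewrite /mdist /= /bipartite_coord; case: (fintype.split i) => j.
- case: x y => [a|b] [a'|b'] /=.
  + exact: ds.
  + by rewrite subr0; exact: (s1 a j).1.
  + by rewrite sub0r; exact: (s1 a' j).2.
  + by rewrite subrr mulr_ge0.
- case: x y => [a|b] [a'|b'] /=.
  + by rewrite subrr mulr_ge0.
  + by rewrite sub0r; exact: (t1 b' j).2.
  + by rewrite subr0; exact: (t1 b j).1.
  + exact: dt.
Qed.

Lemma sign_frame_card_neq0 (C : finType) (n : nat) (r : 'I_n -> C -> R) :
  sign_frame r -> #|C|%:R != 0 :> R.
Proof.
move=> /sign_frame_dipole /(_ (fun=> false)) [c _].
by rewrite pnatr_eq0 -lt0n; apply/card_gt0P; exists c.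
Qed.

Lemma bipartite_frame_biorthogonal i j :
  \sum_x bipartite_frame i x * bipartite_coord j x = (i == j)%:R.
Proof.
have A0 := sign_frame_card_neq0 sP; have B0 := sign_frame_card_neq0 tP.
rewrite sum_bipartite -[i]fintype.splitK -[j]fintype.splitK /=.
under eq_bigr do rewrite ffunE /bipartite_coord !unsplitK.
under [X in _ + X]eq_bigr do rewrite ffunE /bipartite_coord !unsplitK.
rewrite (can_eq (@unsplitK p q)).
case: (fintype.split i) (fintype.split j) => k [l|l] /=.
- rewrite [X in _ + X]big1 => [|b _]; last by rewrite mulr0.
  under eq_bigr do rewrite mulrAC.
  by rewrite -mulr_suml (sign_frame_orth sP) addr0 mulrAC mulfV // mul1r.
- by rewrite !big1 ?addr0 // => ? _; rewrite ?mulr0 // mul0r mul0r.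
- by rewrite !big1 ?addr0 // => ? _; rewrite ?mulr0 // mul0r mul0r.
- rewrite [X in X + _]big1 => [|a _]; last by rewrite mulr0.
  under eq_bigr do rewrite mulrAC.
  by rewrite -mulr_suml (sign_frame_orth tP) add0r mulrAC mulfV // mul1r.
Qed.

Lemma bipartite_frame_norm_le1 (e : 'I_(p + q) -> bool) :
  `|\sum_i (-1) ^+ e i *: bipartite_frame i| <= 1.
Proof.
have A0 := sign_frame_card_neq0 sP; have B0 := sign_frame_card_neq0 tP.
have [a [a' aE]] := sign_frame_dipole sP (e \o lshift q).
have [b [b' bE]] := sign_frame_dipole tP (e \o @rshift p q).
(* The signed sum is half of each of the dipoles [(a, a')] and [(b, b')]. Crossing over, from [a] to
   [b'] and from [b] to [a'], makes each half unit travel distance 1, whereas staying on a side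
   could cost distance 2. *)
pose src (k : bool) : X := if k then inl a else inr b.
pose snk (k : bool) : X := if k then inr b' else inl a'.
rewrite [leRHS](_ : _ = \sum_k 2^-1 * mdist (src k) (snk k)); last first.
  by rewrite big_bool /mdist /=; lra.
apply: tc_norm_le.
suff -> : (\sum_i (-1) ^+ e i *: bipartite_frame i : TC X) =
    \sum_k 2^-1 *: (ind (src k) - ind (snk k)) :> {ffun X -> R^o}.
  by apply: tc_costs_fin => _; rewrite invr_ge0.
have eqL (c d : A) : (inl c == inl d :> X) = (c == d) by [].
have eqR (c d : B) : (inr c == inr d :> X) = (c == d) by [].
rewrite TC_sumE big_bool; apply/ffunP => x; rewrite sum_ffunE.
rewrite [LHS](_ : _ = \sum_i (-1) ^+ e i * bipartite_coord i x /
    (if fintype.split i is inl _ then #|A| else #|B|)%:R); last first.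
  by apply: eq_bigr => i _; rewrite !ffunE -mulrA.
rewrite big_split_ord /= !ffunE /bipartite_coord.
under eq_bigr do rewrite (unsplitK (inl _)).
under [X in _ + X]eq_bigr do rewrite (unsplitK (inr _)).
rewrite -!mulr_suml; case: x => [c|c].
  rewrite aE [X in _ + X / _]big1 => [|i _]; last by rewrite mulr0.
  rewrite /GRing.scale /= !eqL mul0r addr0 subr0 sub0r -mulrDr mulrAC.
  by rewrite (mulrAC _ 2^-1) mulfV // mul1r.
rewrite bE big1 => [|i _]; last by rewrite mulr0.
rewrite /GRing.scale /= !eqR mul0r add0r subr0 sub0r -mulrDr (addrC (- _)) mulrAC.
by rewrite (mulrAC _ 2^-1) mulfV // mul1r.
Qed.

Lemma bipartite_linfty_copy :
  contains_isometric_copy 'rV[R]_(p + q) (TC X).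
Proof.
exact: (biorthogonal_linfty_copy bipartite_coord_lipschitz
  bipartite_frame_biorthogonal bipartite_frame_norm_le1).
Qed.

End BipartiteCopy.

Unset Implicit Arguments.

Theorem mainTheorem6 (R : realType) :
  (exists T : finMetricType R,
     #|T| = 6%N /\ contains_isometric_copy 'rV[R]_3 (TC T)) /\
  (exists F : finMetricType R,
     #|F| = 8%N /\ contains_isometric_copy 'rV[R]_4 (TC F)).
Proof.
split.
(* A side of 4 points carries two coordinates and a side of 2 points carries one: 4 + 2 points give
   dimension 2 + 1, and 4 + 4 points give 2 + 2. *)
- exists (bipartite R (bool * bool)%type bool); split.
    by rewrite card_sum card_prod card_bool.
  exact: (bipartite_linfty_copy (sign_frame_bool2 R) (sign_frame_bool R)).
- exists (bipartite R (bool * bool)%type (bool * bool)%type); split.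
    by rewrite card_sum card_prod card_bool.
  exact: (bipartite_linfty_copy (sign_frame_bool2 R) (sign_frame_bool2 R)).
Qed.
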